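(* Let $\Lambda$ be an artin algebra and $G$ a finite group whose order is invertible in $\Lambda$, acting on $\Lambda$. Suppose that $\Lambda$ is $G$-stable. Then: (i) if the skew group algebra $\Lambda G$ satisfies the Strong Nakayama Conjecture (SNC), then $\Lambda$ satisfies SNC; (ii) if the skew group algebra $\Lambda G$ satisfies the Generalized Nakayama Conjecture (GNC), then $\Lambda$ satisfies GNC.
   Context: Group actions. $G$ acts on $\Lambda$ means there is a map $G\times\Lambda\to\Lambda$, $(\sigma,\lambda)\mapsto\sigma(\lambda)$, such that each $\sigma\in G$ acts as an algebra automorphism of $\Lambda$, $(\sigma_1\sigma_2)(\lambda)=\sigma_1(\sigma_2(\lambda))$, and $1(\lambda)=\lambda$. Skew group algebra. $\Lambda G$ is the free left $\Lambda$-module with basis the elements of $G$, with multiplication $(\lambda_\sigma\sigma)(\lambda_\tau\tau)=(\lambda_\sigma\,\sigma(\lambda_\tau))\,\sigma\tau$ for $\lambda_\sigma,\lambda_\tau\in\Lambda$ and $\sigma,\tau\in G$. With $|G|$ invertible in $\Lambda$, $\Lambda G$ is again an artin algebra. $G$-stability. For a left $\Lambda$-module $X$ and $\sigma\in G$, ${}^{\sigma}X$ is the left $\Lambda$-module with the same underlying additive structure as $X$ and action $\lambda\cdot x=\sigma^{-1}(\lambda)x$. A $\Lambda$-module $X$ is $G$-stable if ${}^{\sigma}X\cong X$ as $\Lambda$-modules for every $\sigma\in G$. $\Lambda$ is $G$-stable if it is $G$-stable as a left $\Lambda$-module. Conjectures as properties of an individual artin algebra $A$, where $\mathrm{mod}\,A$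 is the category of finitely generated left $A$-modules and $\mathrm{Ext}^0=\mathrm{Hom}$: - $A$ satisfies SNC if every $M\in\mathrm{mod}\,A$ with $\mathrm{Ext}_A^i(M,A)=0$ for all $i\geq 0$ is zero. - $A$ satisfies GNC if for every simple $S\in\mathrm{mod}\,A$ there exists $i\geq 0$ with $\mathrm{Ext}_A^i(S,A)\neq 0$. *)

(* Defs.v *)
From HB Require Import structures.
From mathcomp Require Import all_boot all_fingroup all_algebra.

Set Implicit Arguments.
Unset Strict Implicit.
Unset Printing Implicit Defensive.

Import GRing.Theory.
Local Open Scope ring_scope.

Section Modules.
Variable A : pzRingType.
Implicit Types M N P : lmodType A.

Definition finitely_generated M : Prop :=
  exists (n : nat) (v : 'I_n -> M),
    forall x : M, exists c : 'I_n -> A, x = \sum_(i < n) c i *: v i.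

Definition zero_module M : Prop := forall x : M, x = 0.

Definition simple_module M : Prop :=
  ~ zero_module M /\
  forall S : {pred M}, GRing.submod_closed S ->
    (forall x, x \in S -> x = 0) \/ (forall x, x \in S).

Definition isomorphic M N : Prop := exists f : {linear M -> N}, bijective f.

Definition projective P : Prop :=
  forall (M N : lmodType A) (f : {linear M -> N}) (g : {linear P -> N}),
    (forall y, exists x, f x = y) ->
    exists h : {linear P -> M}, forall x, f (h x) = g x.

Record projective_resolution M := ProjectiveResolution {
  pres_obj : nat -> lmodType A;
  pres_diff : forall n, {linear pres_obj n.+1 -> pres_obj n};
  pres_aug : {linear pres_obj 0%N -> M};
  pres_projective : forall n, projective (pres_obj n);
  pres_aug_surj : forall y, exists x, pres_aug x = y;
  pres_aug_exact : forall x,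
    pres_aug x = 0 <-> exists y, pres_diff 0%N y = x;
  pres_diff_exact : forall n x,
    pres_diff n x = 0 <-> exists y, pres_diff n.+1 y = x
}.

(* Ext^n_A(M, N) = 0.  Ext^0 is Hom; in positive degree Ext^n is the n-th     *)
(* cohomology of Hom_A(P, N), which vanishes iff every n-cocycle is a         *)
(* coboundary.  Since the cohomology does not depend on the projective        *)
(* resolution P up to isomorphism, quantifying over all P or asserting the    *)
(* existence of one P is the same.                                            *)
Definition Ext_eq0 (n : nat) M N : Prop :=
  match n with
  | 0 => forall (f : {linear M -> N}) x, f x = 0
  | m.+1 => forall (P : projective_resolution M)
                   (f : {linear pres_obj P m.+1 -> N}),
      (forall x, f (pres_diff P m.+1 x) = 0) ->
      exists h : {linear pres_obj P m -> N},
        forall x, f x = h (pres_diff P m x)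
  end.

End Modules.

Definition SNC (A : pzRingType) : Prop :=
  forall M : lmodType A, finitely_generated M ->
    (forall i : nat, Ext_eq0 i M A^o) -> zero_module M.

Definition GNC (A : pzRingType) : Prop :=
  forall S : lmodType A, finitely_generated S -> simple_module S ->
    exists i : nat, ~ Ext_eq0 i S A^o.

Definition artinian (R : comPzRingType) : Prop :=
  forall I : nat -> {pred R^o},
    (forall n, GRing.submod_closed (I n)) ->
    (forall n x, x \in I n.+1 -> x \in I n) ->
    exists n, forall m, (n <= m)%N -> I m =i I n.

Definition artin_algebra (R : comPzRingType) (L : algType R) : Prop :=
  artinian R /\ finitely_generated L.

Definition invertible (A : pzRingType) (x : A) : Prop :=
  exists y : A, y * x = 1 /\ x * y = 1.

(* Each act s is automatically bijective, with inverse act s^-1. *)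
Record alg_action (G : finGroupType) (R : comPzRingType) (L : algType R) :=
  AlgAction {
    act :> G -> {lrmorphism L -> L};
    act1 : forall x : L, act 1%g x = x;
    actM : forall (s t : G) (x : L), act (s * t)%g x = act s (act t x)
  }.

(* ^sX: the underlying group of X with l . x = s^-1(l) x.                     *)
Definition twisted (G : finGroupType) (R : comPzRingType) (L : algType R)
  (a : alg_action G L) (s : G) (X : lmodType L) : Type := X.

Section Twisted.
Variables (G : finGroupType) (R : comPzRingType) (L : algType R).
Variables (a : alg_action G L) (s : G) (X : lmodType L).
Local Notation Y := (twisted a s X).

HB.instance Definition _ := GRing.Zmodule.copy Y X.

Definition twisted_scale (l : L) (x : Y) : Y := a s^-1%g l *: (x : X).

Fact twisted_scaleA l m (x : Y) :
  twisted_scale l (twisted_scale m x) = twisted_scale (l * m) x.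
Proof. by rewrite /twisted_scale scalerA rmorphM. Qed.

Fact twisted_scale1 : left_id 1 twisted_scale.
Proof. by move=> x; rewrite /twisted_scale rmorph1 scale1r. Qed.

Fact twisted_scaleDr : right_distributive twisted_scale +%R.
Proof. by move=> l x y; rewrite /twisted_scale scalerDr. Qed.

Fact twisted_scaleDl (x : Y) : {morph twisted_scale^~ x : l m / l + m}.
Proof. by move=> l m; rewrite /twisted_scale rmorphD scalerDl. Qed.

HB.instance Definition _ := GRing.Zmodule_isLmodule.Build L Y
  twisted_scaleA twisted_scale1 twisted_scaleDr twisted_scaleDl.

End Twisted.

Definition G_stable (G : finGroupType) (R : comPzRingType) (L : algType R)
    (a : alg_action G L) (X : lmodType L) : Prop :=
  forall s : G, isomorphic (twisted a s X) X.

(* The element \sum_s f(s) s of LG is represented by its coefficient function *)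
(* f : G -> L.                                                                *)
Definition skew_group_algebra (G : finGroupType) (R : comPzRingType)
  (L : algType R) (a : alg_action G L) : Type := {ffun G -> L}.

Section SkewGroupAlgebra.
Variables (G : finGroupType) (R : comPzRingType) (L : algType R).
Variable a : alg_action G L.
Local Notation LG := (skew_group_algebra a).

HB.instance Definition _ := GRing.Lmodule.copy LG {ffun G -> L}.

Definition skew_coef (f : LG) : G -> L := (f : {ffun G -> L}).

Lemma skew_coefP (f g : LG) : skew_coef f =1 skew_coef g -> f = g.
Proof. by move=> fg; apply/ffunP. Qed.

Lemma skew_coefD f g u : skew_coef (f + g) u = skew_coef f u + skew_coef g u.
Proof. by rewrite /skew_coef ffunE. Qed.

Lemma skew_coefZ (r : R) f u : skew_coef (r *: f) u = r *: skew_coef f u.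
Proof. by rewrite /skew_coef ffunE. Qed.

Lemma skew_coef_sum I (r : seq I) (P : pred I) (F : I -> LG) u :
  skew_coef (\sum_(i <- r | P i) F i) u = \sum_(i <- r | P i) skew_coef (F i) u.
Proof.
elim/big_rec2: _ => [|i x y _ <-]; first by rewrite /skew_coef ffunE.
exact: skew_coefD.
Qed.

(* l s, the multiple by l : L of the basis element s : G.                     *)
Definition skew_basis (l : L) (s : G) : LG :=
  [ffun u => if u == s then l else 0].

Definition skew_one : LG := skew_basis 1 1%g.

Definition skew_mul (f g : LG) : LG :=
  [ffun u => \sum_(st : G * G | (st.1 * st.2)%g == u)
     skew_coef f st.1 * a st.1 (skew_coef g st.2)].

Lemma skew_mul_coef f g u :
  skew_coef (skew_mul f g) u =
  \sum_(s : G) skew_coef f s * a s (skew_coef g (s^-1 * u)%g).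
Proof.
rewrite /skew_coef ffunE.
rewrite (reindex_onto (fun s : G => (s, (s^-1 * u)%g)) (fun st => st.1)) /=.
  by apply: eq_bigl => s; rewrite mulKVg !eqxx.
by case=> s t /= /eqP <-; rewrite mulKg.
Qed.

Fact skew_mulA : associative skew_mul.
Proof.
move=> f g h; apply: skew_coefP => u; rewrite !skew_mul_coef.
under eq_bigr => s _ do
  rewrite skew_mul_coef raddf_sum mulr_sumr (reindex_inj (mulgI s^-1%g)) /=.
under [RHS]eq_bigr => s _ do rewrite skew_mul_coef mulr_suml.
rewrite [RHS]exchange_big /=; apply: eq_bigr => s _; apply: eq_bigr => t _.
have -> : ((s^-1 * t)^-1 * (s^-1 * u) = t^-1 * u)%g.
  by rewrite invMg -mulgA mulKg.
by rewrite rmorphM /= -actM mulKVg mulrA.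
Qed.

Fact skew_mul1r : left_id skew_one skew_mul.
Proof.
move=> f; apply: skew_coefP => u; rewrite skew_mul_coef (bigD1 1%g) //= big1.
  by rewrite /skew_coef ffunE eqxx mul1r act1 invg1 mul1g addr0.
by move=> s /negPf s1; rewrite {1}/skew_coef ffunE s1 mul0r.
Qed.

Fact skew_mulr1 : right_id skew_one skew_mul.
Proof.
move=> f; apply: skew_coefP => u; rewrite skew_mul_coef (bigD1 u) //= big1.
  by rewrite /skew_coef ffunE mulVg eqxx rmorph1 mulr1 addr0.
move=> s su; rewrite /skew_coef ffunE -eq_mulVg1 (negPf su).
by rewrite raddf0 mulr0.
Qed.

Fact skew_mulDl : left_distributive skew_mul +%R.
Proof.
move=> f g h; apply: skew_coefP => u; rewrite skew_coefD !skew_mul_coef.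
by rewrite -big_split; apply: eq_bigr => s _; rewrite skew_coefD mulrDl.
Qed.

Fact skew_mulDr : right_distributive skew_mul +%R.
Proof.
move=> f g h; apply: skew_coefP => u; rewrite skew_coefD !skew_mul_coef.
rewrite -big_split; apply: eq_bigr => s _.
by rewrite skew_coefD raddfD mulrDr.
Qed.

HB.instance Definition _ := GRing.Zmodule_isPzRing.Build LG
  skew_mulA skew_mul1r skew_mulr1 skew_mulDl skew_mulDr.

Fact skew_oner_neq0 : (1 : LG) != 0.
Proof.
apply/eqP => /(congr1 (fun f => skew_coef f 1%g)).
by rewrite /skew_coef !ffunE eqxx; apply/eqP/oner_neq0.
Qed.

HB.instance Definition _ := GRing.PzSemiRing_isNonZero.Build LG skew_oner_neq0.

Fact skew_scaleAl (r : R) (f g : LG) : r *: (f * g) = r *: f * g.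
Proof.
apply: skew_coefP => u; rewrite skew_coefZ !skew_mul_coef scaler_sumr.
by apply: eq_bigr => s _; rewrite skew_coefZ scalerAl.
Qed.

Fact skew_scaleAr (r : R) (f g : LG) : r *: (f * g) = f * (r *: g).
Proof.
apply: skew_coefP => u; rewrite skew_coefZ !skew_mul_coef scaler_sumr.
by apply: eq_bigr => s _; rewrite skew_coefZ linearZ scalerAr.
Qed.

HB.instance Definition _ := GRing.Lmodule_isLalgebra.Build R LG skew_scaleAl.
HB.instance Definition _ := GRing.Lalgebra_isAlgebra.Build R LG skew_scaleAr.

Lemma skew_basisM l m s t :
  skew_basis l s * skew_basis m t = skew_basis (l * a s m) (s * t)%g.
Proof.
apply: skew_coefP => u; rewrite skew_mul_coef (bigD1 s) //= big1.
  rewrite /skew_coef !ffunE eqxx addr0 -(inj_eq (mulgI s)) mulKVg.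
  by case: eqP => // _; rewrite raddf0 mulr0.
by move=> r /negPf rs; rewrite /skew_coef !ffunE rs mul0r.
Qed.

Lemma skew_basisE (f : LG) : f = \sum_s skew_basis (skew_coef f s) s.
Proof.
apply: skew_coefP => u; rewrite skew_coef_sum (bigD1 u) //= big1.
  by rewrite {2}/skew_coef ffunE eqxx addr0.
by move=> s su; rewrite {1}/skew_coef ffunE eq_sym (negPf su).
Qed.

End SkewGroupAlgebra.

(* Main.v *)
Require Import Defs.
From HB Require Import structures.
From mathcomp Require Import all_boot all_fingroup all_algebra.
From mathcomp Require Import freeg boolp.

(* Write res for restriction of scalars along L -> LG.  Since LG is           *)
(* coinduced from L, Frobenius reciprocity gives                              *)
(* Ext_LG^n(T, LG) = Ext_L^n(res T, L), and restricting the induced module    *)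
(* LG (x) M gives the direct sum of the twists of M by the elements of G,     *)
(* whose Ext into L vanishes as soon as that of M does (act s itself is an    *)
(* isomorphism from L to its twist).  So if Ext_L^n(M, L) = 0, then           *)
(* Ext_LG^n(T, LG) = 0 for each T such that res T is a direct summand of      *)
(* res (LG (x) M).  For SNC take T = LG (x) M.  For GNC, M is simple, hence   *)
(* res (LG (x) M) is a finite direct sum of simples; T is a minimal nonzero   *)
(* LG-submodule of LG (x) M, and a partial sum of the twists complements it.  *)

Set Implicit Arguments.
Unset Strict Implicit.
Unset Printing Implicit Defensive.

Import GRing.Theory.
Local Open Scope ring_scope.

(** Vanishing of Ext passes from L to LG through a single implication, [Ext_eq0_summand_induced],
    whose contrapositive moves nonvanishing back to L. It combines three facts: [Ext_eq0_skew]
    (Frobenius reciprocity, applied to cocycles), [Ext_eq0_twist] (restriction along an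
    automorphism) and [Ext_eq0_retract] (retracts of finite sums). [SNC_skew] uses that M embeds in
    [induced a M]; [GNC_skew] uses [simple_retract_induced], a relative of Maschke's theorem.

    No Ext group is built. In positive degree [Ext_eq0] speaks of all projective resolutions, so a
    hypothesis may be applied to a convenient resolution, while a conclusion must be reached for an
    arbitrary one. [Ext_eq0_decomposition] bridges the two by dimension shifting, which takes the
    place of a comparison theorem for resolutions. *)

(** * Linear maps, submodules and kernels *)

Section LinearMaps.
Variable A : pzRingType.
Implicit Types M N P : lmodType A.

Definition Linear M N (f : M -> N) (lin_f : linear f) : {linear M -> N} :=
  HB.pack f (GRing.isLinear.Build A M N *:%R f lin_f).

Fact comp_is_linear M N P (g : {linear N -> P}) (f : {linear M -> N}) :
  linear (fun x => g (f x)).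
Proof. by move=> c x y; rewrite !linearP. Qed.

Definition linear_comp M N P g f := Linear (@comp_is_linear M N P g f).

Fact add_is_linear M N (f g : {linear M -> N}) : linear (fun x => f x + g x).
Proof. by move=> c x y; rewrite !linearP scalerDr addrACA. Qed.

Definition linear_add M N f g := Linear (@add_is_linear M N f g).

Fact opp_is_linear M N (f : {linear M -> N}) : linear (fun x => - f x).
Proof. by move=> c x y; rewrite linearP opprD scalerN. Qed.

Definition linear_opp M N f := Linear (@opp_is_linear M N f).

Fact sum_is_linear M N (I : finType) (f : I -> {linear M -> N}) :
  linear (fun x => \sum_i f i x).
Proof.
move=> c x y; rewrite scaler_sumr -big_split.
by apply: eq_bigr => i _; rewrite linearP.
Qed.

Definition linear_sumf M N I f := Linear (@sum_is_linear M N I f).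

Section Submodules.
Variables (M : lmodType A) (S : submodClosed M).

Record submod := Submod { submod_val : M; _ : submod_val \in S }.

HB.instance Definition _ := [isSub for submod_val].
HB.instance Definition _ := [Choice of submod by <:].
HB.instance Definition _ := [SubChoice_isSubLmodule of submod by <:].

Fact val_is_linear : linear (val : submod -> M).
Proof. by move=> c x y; rewrite linearP. Qed.

Definition submod_incl : {linear submod -> M} := Linear val_is_linear.

Section Corestriction.
Variables (N : lmodType A) (f : {linear N -> M}) (Sf : forall x, f x \in S).

Definition corestrict_fun (x : N) : submod := Submod (Sf x).

Fact corestrict_is_linear : linear corestrict_fun.
Proof. by move=> c x y; apply: val_inj; rewrite linearP /= linearP. Qed.

Definition corestrict := Linear corestrict_is_linear.

End Corestriction.
End Submodules.

Section Kernel.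
Variables (M N : lmodType A) (f : {linear M -> N}).

Definition kernel_pred : {pred M} := [pred x | f x == 0].

Fact kernel_closed : GRing.submod_closed kernel_pred.
Proof.
split=> [|c x y]; rewrite !inE ?linear0 // => /eqP fx /eqP fy.
by rewrite linearP fx fy scaler0 addr0.
Qed.

HB.instance Definition _ :=
  GRing.isSubmodClosed.Build A M kernel_pred kernel_closed.

Definition kernel : lmodType A := submod kernel_pred.

Lemma kernelP (x : kernel) : f (val x) = 0.
Proof. by apply/eqP; apply: (valP x). Qed.

End Kernel.
End LinearMaps.

(** * Free modules and the canonical free resolution *)

Section FreeModule.
Variable A : nzRingType.
Implicit Types M : lmodType A.

Section Lift.
Variables (K : choiceType) (M : lmodType A) (u : K -> M).

HB.instance Definition _ :=
  GRing.isZmodMorphism.Build {freeg K / A} M (fglift u)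
    (@lift_is_additive A K M u).

Fact fglift_is_linear : linear (fglift u : {freeg K / A} -> M).
Proof.
move=> c x y; rewrite raddfD; congr (_ + _).
have -> : c *: x = \sum_(k <- dom x) << c * coeff k x *g k >> by [].
rewrite -[in RHS](freeg_sumE x) 2!raddf_sum scaler_sumr /=.
apply: eq_bigr => k _.
by rewrite !liftU scalerA.
Qed.

Definition free_lift : {linear {freeg K / A} -> M} := Linear fglift_is_linear.

Lemma free_lift1 k : free_lift << k >> = u k.
Proof. by rewrite /free_lift /= liftU scale1r. Qed.

End Lift.

Lemma free_lift_unique (K : choiceType) M (f g : {linear {freeg K / A} -> M}) :
  (forall k, f << k >> = g << k >>) -> f =1 g.
Proof.
move=> fg x; rewrite -(freeg_sumE x) !linear_sum; apply: eq_bigr => k _ /=.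
suff -> : << coeff k x *g k >> = coeff k x *: (<< k >> : {freeg K / A}).
  by rewrite !linearZ fg.
apply/eqP/freeg_eqP => l; rewrite coeffZ !coeffU mul1r.
by [].
Qed.

Lemma free_projective (K : choiceType) : projective {freeg K / A}.
Proof.
move=> M N f g f_surj.
have pre k : exists x, f x == g << k >>.
  by have [x fx] := f_surj (g << k >>); exists x; apply/eqP.
exists (free_lift (fun k => xchoose (pre k))).
apply: (@free_lift_unique _ _ (linear_comp f (free_lift _)) g) => k.
by rewrite /= -[fglift _ _]/(free_lift _ _) free_lift1;
  apply/eqP/(xchooseP (pre k)).
Qed.

Definition free_cover M : {linear {freeg M / A} -> M} := free_lift id.

Lemma free_cover_surj M y : exists x, free_cover M x = y.
Proof. by exists << y >>; rewrite free_lift1. Qed.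

Definition syzygy M : lmodType A := kernel (free_cover M).

Definition syzygy_diff M : {linear {freeg (syzygy M) / A} -> {freeg M / A}} :=
  linear_comp (submod_incl _) (free_cover (syzygy M)).

Fact syzygy_diff_exact M x :
  free_cover M x = 0 <-> exists y, syzygy_diff M y = x.
Proof.
split=> [x0 | [y <-]]; last exact: kernelP.
have Kx : x \in kernel_pred (free_cover M) by rewrite inE x0.
have [y yx] := free_cover_surj (Submod Kx : syzygy M).
by exists y; rewrite -[RHS]/(val (Submod Kx : syzygy M)) -yx.
Qed.

Fact syzygy_exact M x :
  syzygy_diff M x = 0 <-> exists y, syzygy_diff (syzygy M) y = x.
Proof.
split=> [x0 | /syzygy_diff_exact x0].
  by apply/syzygy_diff_exact/val_inj.
by rewrite -[LHS]/(val (free_cover (syzygy M) x)) x0.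
Qed.

Definition free_resolution M : projective_resolution M :=
  @ProjectiveResolution A M
    (fun n => {freeg (iter n syzygy M) / A})
    (fun n => syzygy_diff (iter n syzygy M))
    (free_cover M)
    (fun n => @free_projective _)
    (free_cover_surj (M := M))
    (@syzygy_diff_exact M)
    (fun n => @syzygy_exact (iter n syzygy M)).

End FreeModule.

(** * Truncating and splicing resolutions; lifting decompositions to syzygies *)

Section Resolutions.
Variable A : pzRingType.
Implicit Types M N Z : lmodType A.

Section Tail.
Variables (M : lmodType A) (P : projective_resolution M).

Fact pres_diff0_ker x : pres_diff P 0%N x \in kernel_pred (pres_aug P).
Proof. by rewrite inE; apply/eqP/pres_aug_exact; exists x. Qed.

Definition tail_aug : {linear pres_obj P 1%N -> kernel (pres_aug P)} :=
  corestrict pres_diff0_ker.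

Fact tail_aug_surj y : exists x, tail_aug x = y.
Proof.
have /pres_aug_exact[x xy] := kernelP y.
by exists x; apply: val_inj.
Qed.

Fact tail_aug_exact x : tail_aug x = 0 <-> exists y, pres_diff P 1%N y = x.
Proof.
split=> [x0 | /pres_diff_exact x0]; last exact: val_inj.
by apply/pres_diff_exact; rewrite -[LHS]/(val (tail_aug x)) x0.
Qed.

Definition tail_resolution : projective_resolution (kernel (pres_aug P)) :=
  @ProjectiveResolution A _ (fun n => pres_obj P n.+1)
    (fun n => pres_diff P n.+1) tail_aug
    (fun n => @pres_projective _ _ P n.+1) tail_aug_surj tail_aug_exact
    (fun n => @pres_diff_exact _ _ P n.+1).

End Tail.

Section Splice.
Variables (M Q : lmodType A) (q : {linear Q -> M}).
Hypotheses (projQ : projective Q) (q_surj : forall y, exists x, q x = y).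
Variable P : projective_resolution (kernel q).

Definition splice_obj n : lmodType A := if n is m.+1 then pres_obj P m else Q.

Definition splice_diff n : {linear splice_obj n.+1 -> splice_obj n} :=
  match n return {linear splice_obj n.+1 -> splice_obj n} with
  | 0 => linear_comp (submod_incl _) (pres_aug P)
  | m.+1 => pres_diff P m
  end.

Fact splice_projective n : projective (splice_obj n).
Proof. by case: n => [|n] //; apply: pres_projective. Qed.

Fact splice_aug_exact x : q x = 0 <-> exists y, splice_diff 0%N y = x.
Proof.
split=> [x0 | [y <-]]; last exact: kernelP.
have Kx : x \in kernel_pred q by rewrite inE x0.
have [y yx] := pres_aug_surj P (Submod Kx : kernel q).
by exists y; rewrite -[RHS]/(val (Submod Kx : kernel q)) -yx.
Qed.

Fact splice_diff_exact n x :
  splice_diff n x = 0 <-> exists y, splice_diff n.+1 y = x.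
Proof.
case: n x => [|n] x; last exact: pres_diff_exact.
split=> [x0 | /pres_aug_exact x0].
  by apply/pres_aug_exact/val_inj.
by rewrite -[LHS]/(val (pres_aug P x)) x0.
Qed.

(** This is how vanishing for M is turned into vanishing for its syzygy [kernel q]: any resolution
    of the kernel extends to one of M, shifting degrees by one. *)
Definition splice_resolution : projective_resolution M :=
  @ProjectiveResolution A M splice_obj splice_diff q splice_projective q_surj
    splice_aug_exact splice_diff_exact.

Lemma Ext_eq0_kernel n Z : Ext_eq0 n.+2 M Z ->
  forall f : {linear pres_obj P n.+1 -> Z},
    (forall x, f (pres_diff P n.+1 x) = 0) ->
    exists h : {linear pres_obj P n -> Z}, forall x, f x = h (pres_diff P n x).
Proof. by move=> Ext0; apply: (Ext0 splice_resolution). Qed.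

(** By the long exact sequence, Ext^1(M, Z) is the cokernel of Hom(Q, Z) -> Hom(ker q, Z). *)
Lemma Ext1_eq0_extend Z : Ext_eq0 1 M Z ->
  forall f : {linear kernel q -> Z},
    exists h : {linear Q -> Z}, forall x, f x = h (val x).
Proof.
move=> Ext0 f.
have [|h hE] := Ext0 splice_resolution (linear_comp f (pres_aug P)).
  move=> x; rewrite -[LHS]/(f (pres_aug P (pres_diff P 0%N x))).
  suff -> : pres_aug P (pres_diff P 0%N x) = 0 by rewrite linear0.
  by apply/pres_aug_exact; exists x.
exists h => x; have [y <-] := pres_aug_surj P x.
exact: hE.
Qed.

End Splice.

Lemma factor_through_surj M N Z (d : {linear M -> N}) (f : {linear M -> Z}) :
    (forall y, exists x, d x = y) -> (forall x, d x = 0 -> f x = 0) ->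
  exists g : {linear N -> Z}, forall x, g (d x) = f x.
Proof.
move=> d_surj ker_d.
have pre y : exists x, d x == y by have [x dx] := d_surj y; exists x; apply/eqP.
pose s y := xchoose (pre y).
have sK y : d (s y) = y by apply/eqP/(xchooseP (pre y)).
have eq_f x y : d x = d y -> f x = f y.
  move=> dxy; apply/eqP; rewrite -subr_eq0 -linearB; apply/eqP/ker_d.
  by rewrite linearB /= dxy subrr.
(* The chosen section [s] of [d] need not be additive; [f] does not see this, being constant on the
   fibres of [d]. *)
have g_lin : linear (fun y => f (s y)).
  by move=> c x y; rewrite -linearP; apply: eq_f; rewrite linearP !sK.
by exists (Linear g_lin) => x; apply: eq_f; rewrite sK.
Qed.

(* If the u i \o v i sum up to the identity of T modulo a map that factors    *)
(* through a projective, then so do their lifts on the first syzygies.        *)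
Lemma lift_decomposition (T P0 F : lmodType A) (p : {linear P0 -> T})
    (I : finType) (N Q : I -> lmodType A) (q : forall i, {linear Q i -> N i})
    (u : forall i, {linear N i -> T}) (v : forall i, {linear T -> N i})
    (al : {linear T -> F}) (be : {linear F -> T}) :
    projective P0 -> (forall y, exists x, p x = y) ->
    (forall i, projective (Q i)) -> (forall i y, exists x, q i x = y) ->
    projective F ->
    (forall t, t = \sum_i u i (v i t) + be (al t)) ->
  exists (U : forall i, {linear Q i -> P0}) (V : forall i, {linear P0 -> Q i})
         (s : {linear P0 -> P0}),
    [/\ forall i x, p (U i x) = u i (q i x),
        forall i x, q i (V i x) = v i (p x),
        forall x, p (s x) = 0
      & forall x, p x = 0 -> x = \sum_i U i (V i x) + s x].
Proof.
move=> projP p_surj projQ q_surj projF idE.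
have /fin_all_exists[U UE] i : exists U : {linear Q i -> P0},
    forall x, p (U x) = u i (q i x).
  exact: (projQ i _ _ p (linear_comp (u i) (q i)) p_surj).
have /fin_all_exists[V VE] i : exists V : {linear P0 -> Q i},
    forall x, q i (V x) = v i (p x).
  exact: (projP _ _ (q i) (linear_comp (v i) p) (q_surj i)).
have [b bE] := projF _ _ p be p_surj.
pose UV i := linear_comp (U i) (V i).
(* [s] is the defect of [w] from the identity. It is killed by [p] because [w] lifts the
   decomposition [idE]; on the kernel of [p] the term of [w] through [al] drops out. *)
pose w := linear_add (linear_sumf UV) (linear_comp b (linear_comp al p)).
pose s := linear_add idfun (linear_opp w).
exists U, V, s; split=> // [x|x px]; rewrite /s /w /=.
  rewrite linearB linearD linear_sum /= bE [in X in X - _](idE (p x)).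
  rewrite (eq_bigr _ (fun i _ => UE i _)).
  by rewrite (eq_bigr _ (fun i _ => congr1 (u i) (VE i x))) subrr.
by rewrite px !linear0 addr0 addrC subrK.
Qed.

End Resolutions.

(** * Vanishing of Ext for retracts of finite sums *)

Section ExtRetract.
Variable A : nzRingType.

(* Dimension shifting: in degree n.+2, tail_resolution P and the syzygies of  *)
(* the N i replace P and the N i, at the cost of a new projective F.          *)
Lemma Ext_eq0_decomposition (n : nat) (Z T : lmodType A)
    (P : projective_resolution T) (I : finType) (N : I -> lmodType A)
    (F : lmodType A)
    (u : forall i, {linear N i -> T}) (v : forall i, {linear T -> N i})
    (al : {linear T -> F}) (be : {linear F -> T}) :
    projective F -> (forall t, t = \sum_i u i (v i t) + be (al t)) ->
    (forall i, Ext_eq0 n.+1 (N i) Z) ->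
  forall f : {linear pres_obj P n.+1 -> Z},
    (forall x, f (pres_diff P n.+1 x) = 0) ->
    exists h : {linear pres_obj P n -> Z}, forall x, f x = h (pres_diff P n x).
Proof.
elim: n => [|n IHn] in T P N F u v al be * => projF idE Ext0 f fd0.
all: have [U [V [s [UE VE s_ker wE]]]] := lift_decomposition
  (@pres_projective _ _ P 0%N) (pres_aug_surj P)
  (fun i => @free_projective A (N i))
  (fun i => free_cover_surj (M := N i)) projF idE.
all: pose K := kernel (pres_aug P).
all: have U_ker i (x : syzygy (N i)) : U i (val x) \in kernel_pred (pres_aug P)
  by rewrite inE UE kernelP linear0.
all: pose U' i : {linear syzygy (N i) -> K} := corestrict
  (U_ker i : forall x, linear_comp (U i) (submod_incl _) x \in _).
all: have V_ker i (x : K) : V i (val x) \in kernel_pred (free_cover (N i))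
  by rewrite inE VE kernelP linear0.
all: pose V' i : {linear K -> syzygy (N i)} := corestrict
  (V_ker i : forall x, linear_comp (V i) (submod_incl _) x \in _).
all: have s_ker' x : s x \in kernel_pred (pres_aug P) by rewrite inE s_ker.
all: pose s' : {linear _ -> K} := corestrict s_ker'.
(* The invariant of the induction: the identity of K splits in the same way, with [pres_obj P 0] as
   the new projective. *)
all: have idK (x : K) : x = \sum_i U' i (V' i x) + s' (val x).
1,3: by apply: val_inj; rewrite linearD linear_sum /= -wE // kernelP.
(* The cocycle descends to [g] on K. Each [g] after [U' i] extends to the free cover of [N i] since
   Ext^1 vanishes; composing with [V i] and adding [g] after [s'] extends [g] to [pres_obj P 0]. *)
- have [g gE] : exists g : {linear K -> Z}, forall x, g (tail_aug P x) = f x.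
    apply: factor_through_surj; first exact: tail_aug_surj.
    by move=> x /tail_aug_exact[y <-].
  have /fin_all_exists[h hE] i : exists h : {linear {freeg (N i) / A} -> Z},
      forall x : syzygy (N i), g (U' i x) = h (val x).
    exact: (Ext1_eq0_extend (@free_projective A (N i))
      (@free_cover_surj _ (N i)) (free_resolution _) (Ext0 i)
      (linear_comp g (U' i))).
  pose hV i := linear_comp (h i) (V i).
  exists (linear_add (linear_sumf hV) (linear_comp g s')).
  move=> x; rewrite -gE [in LHS](idK (tail_aug P x)) linearD linear_sum /=.
  by congr (_ + _); apply: eq_bigr => i _; rewrite hE.
apply: (IHn K (tail_resolution P) (fun i => syzygy (N i)) _ U' V'
  (submod_incl _) s') => // [|i R g].
  exact: pres_projective.
exact: (Ext_eq0_kernel (@free_projective A (N i))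
  (@free_cover_surj _ (N i)) (Ext0 i)).
Qed.

Lemma Ext_eq0_retract (n : nat) (Z T : lmodType A) (I : finType)
    (N : I -> lmodType A)
    (u : forall i, {linear N i -> T}) (v : forall i, {linear T -> N i}) :
    (forall t, t = \sum_i u i (v i t)) -> (forall i, Ext_eq0 n (N i) Z) ->
  Ext_eq0 n T Z.
Proof.
case: n => [|n] idE Ext0 => [f x|P].
  rewrite (idE x) linear_sum big1 // => i _.
  exact: (Ext0 i (linear_comp f (u i))).
(* There is no projective error term here: [al] is zero, and [pres_aug P] is merely some map from a
   projective to T. *)
apply: (@Ext_eq0_decomposition n Z T P I N _ u v
  (GRing.null_fun _ : {linear T -> pres_obj P 0%N}) (pres_aug P)) => // [|t].
  exact: pres_projective.
by rewrite linear0 addr0.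
Qed.

End ExtRetract.

(** * Restriction of scalars *)

Section Restriction.
Variables (A B : pzRingType) (phi : {rmorphism A -> B}).

(* phi is a phantom parameter that selects the A-module structure on X.       *)
Definition restrict_type of {rmorphism A -> B} :=
  fun X : lmodType B => X : Type.

Section Module.
Variable X : lmodType B.
Local Notation Y := (restrict_type phi X).

HB.instance Definition _ := GRing.Zmodule.copy Y X.

Definition restrict_scale (c : A) (x : Y) : Y := phi c *: (x : X).

Fact restrict_scaleA c d (x : Y) :
  restrict_scale c (restrict_scale d x) = restrict_scale (c * d) x.
Proof. by rewrite /restrict_scale scalerA rmorphM. Qed.

Fact restrict_scale1 : left_id 1 restrict_scale.
Proof. by move=> x; rewrite /restrict_scale rmorph1 scale1r. Qed.

Fact restrict_scaleDr : right_distributive restrict_scale +%R.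
Proof. by move=> c x y; rewrite /restrict_scale scalerDr. Qed.

Fact restrict_scaleDl (x : Y) : {morph restrict_scale^~ x : c d / c + d}.
Proof. by move=> c d; rewrite /restrict_scale rmorphD scalerDl. Qed.

HB.instance Definition _ := GRing.Zmodule_isLmodule.Build A Y
  restrict_scaleA restrict_scale1 restrict_scaleDr restrict_scaleDl.

End Module.

Definition restrict (X : lmodType B) : lmodType A := restrict_type phi X.

Lemma restrictZ (X : lmodType B) (c : A) (x : restrict X) :
  c *: x = phi c *: (x : X).
Proof. by []. Qed.

Section Morphism.
Variables (X Y : lmodType B) (f : {linear X -> Y}).

Fact restrict_is_linear : linear (f : restrict X -> restrict Y).
Proof. by move=> c x y; rewrite !restrictZ; apply: linearP. Qed.

Definition restrict_linear : {linear restrict X -> restrict Y} :=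
  Linear restrict_is_linear.

End Morphism.

Section Resolution.
Hypothesis restrict_projective :
  forall P : lmodType B, projective P -> projective (restrict P).
Variables (M : lmodType B) (P : projective_resolution M).

Definition restrict_resolution : projective_resolution (restrict M) :=
  @ProjectiveResolution A (restrict M) (fun n => restrict (pres_obj P n))
    (fun n => restrict_linear (pres_diff P n)) (restrict_linear (pres_aug P))
    (fun n => restrict_projective (@pres_projective _ _ P n))
    (pres_aug_surj P) (@pres_aug_exact _ _ P) (@pres_diff_exact _ _ P).

End Resolution.
End Restriction.

(** * Twisting by a ring automorphism *)

Section Twist.
Variables (A : pzRingType) (phi psi : {rmorphism A -> A}).
Hypotheses (phiK : cancel phi psi) (psiK : cancel psi phi).

Lemma restrict_iso_projective (P : lmodType A) :
  projective P -> projective (restrict psi P).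
Proof.
move=> projP M N f g f_surj.
have g_lin : linear (g : P -> restrict phi N).
  by move=> c x y; rewrite restrictZ -linearP restrictZ phiK.
have [h hE] := projP _ _ (restrict_linear phi f) (Linear g_lin) f_surj.
have h_lin : linear (h : restrict psi P -> M).
  by move=> c x y; rewrite restrictZ [LHS]linearP restrictZ psiK.
by exists (Linear h_lin) => x; apply: hE.
Qed.

(** Restriction along [psi] takes resolutions of the twist to resolutions of M, and composing with
    [phi] turns maps from the twist to A into linear maps from M to A. *)
Lemma Ext_eq0_twist (n : nat) (M : lmodType A) :
  Ext_eq0 n M A^o -> Ext_eq0 n (restrict phi M) A^o.
Proof.
case: n => [|n] Ext0 => [f x|P f fd0].
  have f_lin : linear ((fun y => phi (f y)) : M -> A^o).
    move=> c y z.
    have -> : c *: y = psi c *: (y : restrict phi M) by rewrite restrictZ psiK.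
    by rewrite linearP rmorphD; congr (_ + _); rewrite [LHS]rmorphM psiK.
  by rewrite -[f x]phiK -[phi _]/(Linear f_lin x) Ext0 rmorph0.
pose aug := pres_aug P.
have aug_lin : linear (aug : restrict psi (pres_obj P 0%N) -> M).
  by move=> c x y; rewrite restrictZ [LHS]linearP restrictZ psiK.
pose Q := @ProjectiveResolution A M (fun n => restrict psi (pres_obj P n))
    (fun n => restrict_linear psi (pres_diff P n)) (Linear aug_lin)
    (fun n => restrict_iso_projective (@pres_projective _ _ P n))
    (pres_aug_surj P) (@pres_aug_exact _ _ P) (@pres_diff_exact _ _ P).
have f_lin : linear ((fun x => phi (f x)) : pres_obj Q n.+1 -> A^o).
  move=> c x y; rewrite [_ *: x]restrictZ linearP rmorphD.
  by congr (_ + _); rewrite [LHS]rmorphM psiK.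
have [x|h hE] := Ext0 Q (Linear f_lin); first by rewrite /= fd0 rmorph0.
have h_lin : linear ((fun x => psi (h x)) : pres_obj P n -> A^o).
  move=> c x y.
  have -> : c *: x = phi c *: (x : restrict psi _) by rewrite restrictZ phiK.
  by rewrite linearP rmorphD; congr (_ + _); rewrite [LHS]rmorphM phiK.
by exists (Linear h_lin) => x; rewrite /= -hE /= phiK.
Qed.

End Twist.

(** * Induced modules and Frobenius reciprocity *)

Section Induction.
Variables (G : finGroupType) (R : comPzRingType) (L : algType R).
Variable a : alg_action G L.
Local Notation LG := (skew_group_algebra a).

Definition skew_const (l : L) : LG := skew_basis a l 1%g.

Fact skew_const_zmod : zmod_morphism skew_const.
Proof.
move=> l m; apply: skew_coefP => u.
rewrite skew_coefD /skew_coef !ffunE.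
by case: ifP; rewrite ?subrr.
Qed.

Fact skew_const_monoid : monoid_morphism skew_const.
Proof. by split=> // l m; rewrite /skew_const skew_basisM Defs.act1 mulg1. Qed.

HB.instance Definition _ :=
  GRing.isZmodMorphism.Build L LG skew_const skew_const_zmod.
HB.instance Definition _ :=
  GRing.isMonoidMorphism.Build L LG skew_const skew_const_monoid.

Lemma skew_basis_const l s : skew_basis a l s = skew_const l * skew_basis a 1 s.
Proof. by rewrite skew_basisM mul1g Defs.act1 mulr1. Qed.

Lemma skew_coef_const l (c : LG) u :
  skew_coef (skew_const l * c) u = l * skew_coef c u.
Proof.
rewrite skew_mul_coef (bigD1 1%g) //= big1 => [|s /negPf s1].
  by rewrite {1}/skew_coef ffunE eqxx Defs.act1 invg1 mul1g addr0.
by rewrite {1}/skew_coef ffunE s1 mul0r.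
Qed.

Lemma skew_coef_basis1 s (c : LG) u :
  skew_coef (skew_basis a 1 s * c) u = a s (skew_coef c (s^-1 * u)%g).
Proof.
rewrite skew_mul_coef (bigD1 s) //= big1 => [|t /negPf ts].
  by rewrite {1}/skew_coef ffunE eqxx mul1r addr0.
by rewrite {1}/skew_coef ffunE ts mul0r.
Qed.

(* LG (x)_L M, whose element \sum_u u (x) F(u) is represented by F.           *)
Definition induced_type of alg_action G L :=
  fun M : lmodType L => {ffun G -> M} : Type.

Section Module.
Variable M : lmodType L.
Local Notation X := (induced_type a M).

HB.instance Definition _ := GRing.Zmodule.copy X {ffun G -> M}.

Definition ind_coef (F : X) : G -> M := (F : {ffun G -> M}).

Lemma ind_coefP (F H : X) : ind_coef F =1 ind_coef H -> F = H.
Proof. by move=> FH; apply/ffunP. Qed.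

Lemma ind_coefD F H u : ind_coef (F + H) u = ind_coef F u + ind_coef H u.
Proof. by rewrite /ind_coef ffunE. Qed.

(** The rule is l s (v (x) m) = s v (x) (s v)^-1(l) m, read off at u = s v. *)
Definition ind_scale (c : LG) (F : X) : X :=
  [ffun u => \sum_s a u^-1%g (skew_coef c s) *: ind_coef F (s^-1 * u)%g].

Lemma ind_scaleE c F u : ind_coef (ind_scale c F) u =
  \sum_s a u^-1%g (skew_coef c s) *: ind_coef F (s^-1 * u)%g.
Proof. by rewrite /ind_coef ffunE. Qed.

Fact ind_scaleA c d F : ind_scale c (ind_scale d F) = ind_scale (c * d) F.
Proof.
apply: ind_coefP => u; rewrite !ind_scaleE.
under eq_bigr => s _ do
  rewrite ind_scaleE scaler_sumr (reindex_inj (mulgI s^-1%g)) /=.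
under [RHS]eq_bigr => s _ do rewrite skew_mul_coef rmorph_sum scaler_suml.
rewrite [RHS]exchange_big /=; apply: eq_bigr => s _; apply: eq_bigr => t _.
have -> : ((s^-1 * t)^-1 * (s^-1 * u) = t^-1 * u)%g.
  by rewrite invMg -mulgA mulKg.
by rewrite scalerA rmorphM /= -Defs.actM invMg invgK.
Qed.

Lemma ind_scale_basis l s F u :
  ind_coef (ind_scale (skew_basis a l s) F) u =
  a u^-1%g l *: ind_coef F (s^-1 * u)%g.
Proof.
rewrite ind_scaleE (bigD1 s) //= big1 => [|t /negPf ts].
  by rewrite {1}/skew_coef ffunE eqxx addr0.
by rewrite {1}/skew_coef ffunE ts rmorph0 scale0r.
Qed.

Fact ind_scale1 : left_id 1 ind_scale.
Proof.
move=> F; apply: ind_coefP => u.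
by rewrite ind_scale_basis rmorph1 scale1r invg1 mul1g.
Qed.

Fact ind_scaleDr : right_distributive ind_scale +%R.
Proof.
move=> c F H; apply: ind_coefP => u; rewrite ind_coefD !ind_scaleE -big_split.
by apply: eq_bigr => s _; rewrite ind_coefD scalerDr.
Qed.

Fact ind_scaleDl (F : X) : {morph ind_scale^~ F : c d / c + d}.
Proof.
move=> c d; apply: ind_coefP => u; rewrite ind_coefD !ind_scaleE -big_split.
by apply: eq_bigr => s _; rewrite skew_coefD rmorphD scalerDl.
Qed.

HB.instance Definition _ := GRing.Zmodule_isLmodule.Build LG X
  ind_scaleA ind_scale1 ind_scaleDr ind_scaleDl.

End Module.

Definition induced (M : lmodType L) : lmodType LG := induced_type a M.

Lemma induced_scale_basis (M : lmodType L) l s (F : induced M) u :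
  ind_coef (skew_basis a l s *: F) u = a u^-1%g l *: ind_coef F (s^-1 * u)%g.
Proof. exact: ind_scale_basis. Qed.

Local Notation res := (restrict skew_const).

Section Frobenius.
Variables (X : lmodType LG) (N : lmodType L) (g : {linear res X -> N}).

(** As G is finite, induction is also coinduction, hence right adjoint to restriction; this is the
    adjoint of [g]. *)
Definition frobenius_fun (x : X) : induced N :=
  [ffun u => g (skew_basis a 1 u^-1%g *: x)].

Fact frobenius_is_linear : linear frobenius_fun.
Proof.
move=> c x y; apply: ind_coefP => u.
rewrite ind_coefD [in RHS]ind_scaleE /ind_coef !ffunE.
rewrite scalerDr [LHS]linearD; congr (_ + _).
rewrite {1}(skew_basisE c) scalerA mulr_sumr scaler_suml [LHS]linear_sum.
apply: eq_bigr => s _; rewrite !ffunE /=.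
rewrite skew_basisM mul1r skew_basis_const -scalerA.
by rewrite -[_ *: (_ *: x)]/(_ *: (_ : res X)) linearZ invMg invgK.
Qed.

Definition frobenius := Linear frobenius_is_linear.

Lemma frobeniusE x u :
  ind_coef (frobenius x) u = g (skew_basis a 1 u^-1%g *: x).
Proof. by rewrite /ind_coef ffunE. Qed.

Lemma frobenius1 x : ind_coef (frobenius x) 1%g = g x.
Proof. by rewrite frobeniusE invg1 scale1r. Qed.

End Frobenius.
End Induction.

(** * Ext over the skew group algebra; the case of SNC *)

Section ExtSkew.
Variables (G : finGroupType) (R : comPzRingType) (L : algType R).
Variable a : alg_action G L.
Local Notation LG := (skew_group_algebra a).
Local Notation res := (restrict (@skew_const _ _ _ a)).

Section InducedMap.
Variables (M N : lmodType L) (f : {linear M -> N}).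

Definition induced_map_fun (F : induced a M) : induced a N :=
  [ffun u => f (ind_coef F u)].

Lemma induced_mapE F u : ind_coef (induced_map_fun F) u = f (ind_coef F u).
Proof. by rewrite [LHS]ffunE. Qed.

Fact induced_map_is_linear : linear induced_map_fun.
Proof.
move=> c F H; apply: ind_coefP => u.
rewrite ind_coefD ind_scaleE !induced_mapE ind_coefD ind_scaleE linearD.
rewrite linear_sum; congr (_ + _).
by apply: eq_bigr => s _; rewrite linearZ induced_mapE.
Qed.

Definition induced_map := Linear induced_map_is_linear.

End InducedMap.

Lemma induced_eval1_is_linear (M : lmodType L) :
  linear (fun F : res (induced a M) => ind_coef (F : induced a M) 1%g).
Proof.
move=> l F H; rewrite ind_coefD; congr (_ + _).
by rewrite [LHS]induced_scale_basis invg1 mul1g Defs.act1.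
Qed.

(** Restriction has an exact right adjoint: lift the adjoint of [g] along [induced_map f], then
    evaluate at 1. *)
Lemma restrict_skew_projective (P : lmodType LG) :
  projective P -> projective (res P).
Proof.
move=> projP M N f g f_surj.
have pre y : exists x, f x == y by have [x fx] := f_surj y; exists x; apply/eqP.
have [F|h hE] := projP _ _ (induced_map f) (frobenius g).
  exists ([ffun u => xchoose (pre (ind_coef F u))] : induced a M).
  apply: ind_coefP => u; rewrite [LHS]induced_mapE {1}/ind_coef ffunE.
  exact/eqP/(xchooseP (pre _)).
exists (linear_comp (Linear (@induced_eval1_is_linear M))
                  (restrict_linear _ h)) => x.
by rewrite -(frobenius1 g) -hE [RHS]induced_mapE.
Qed.

(** The map u (x) l |-> u l = u(l) u from LG (x) L to LG. *)
Fact induced_to_skew_is_linear :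
  linear (fun F : induced a L^o => [ffun u => a u (ind_coef F u)] : LG^o).
Proof.
move=> c F H; apply: skew_coefP => u.
rewrite skew_coefD [in RHS]skew_mul_coef /skew_coef !ffunE.
rewrite ind_coefD ind_scaleE rmorphD rmorph_sum; congr (_ + _).
apply: eq_bigr => s _; rewrite rmorphM ffunE /=; congr (_ * _).
  by rewrite -Defs.actM mulgV Defs.act1.
by rewrite -Defs.actM mulKVg.
Qed.

Definition induced_to_skew := Linear induced_to_skew_is_linear.

Fact skew_coef1_is_linear :
  linear (fun c : res LG^o => skew_coef (c : LG) 1%g : L^o).
Proof. by move=> l c d; rewrite skew_coefD [in LHS]skew_coef_const. Qed.

Definition skew_coef1 := Linear skew_coef1_is_linear.

(** A map into LG is thus determined by its coefficient at 1, which is how maps to LG and maps of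
    the restriction to L correspond. *)
Lemma skew_coef_frobenius (X : lmodType LG) (f : {linear X -> LG^o}) x u :
  skew_coef (f x : LG) u = a u (skew_coef1 (f (skew_basis a 1 u^-1%g *: x))).
Proof.
rewrite linearZ /= [in RHS]skew_coef_basis1 invgK mulg1.
by rewrite -Defs.actM mulgV Defs.act1.
Qed.

(** Taking the coefficient at 1 gives a cocycle over L on the restricted resolution; the adjoint of
    a cobounding map, followed by [induced_to_skew], cobounds the original cocycle. *)
Lemma Ext_eq0_skew (n : nat) (T : lmodType LG) :
  Ext_eq0 n (res T) L^o -> Ext_eq0 n T LG^o.
Proof.
case: n => [|n] Ext0 => [f x|P f fd0].
  apply: skew_coefP => u; rewrite skew_coef_frobenius.
  have /= -> := Ext0 (linear_comp skew_coef1 (restrict_linear _ f)).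
  by rewrite rmorph0 /skew_coef ffunE.
have [x|h hE] := Ext0 (restrict_resolution restrict_skew_projective P)
    (linear_comp skew_coef1 (restrict_linear _ f)).
  by rewrite [LHS](congr1 skew_coef1 (fd0 x)) linear0.
exists (linear_comp induced_to_skew (frobenius h)) => x.
apply: skew_coefP => u; rewrite skew_coef_frobenius [in RHS]/skew_coef ffunE.
by rewrite frobeniusE -linearZ; congr (a u _); apply: hE.
Qed.

Section Decomposition.
Variables (M : lmodType L).

Definition ind_basis (u : G) (x : M) : induced a M :=
  [ffun w => if w == u then x else 0].

Lemma ind_basisE (F : induced a M) : F = \sum_u ind_basis u (ind_coef F u).
Proof.
apply: ind_coefP => w.
rewrite (big_morph (fun F : induced a M => ind_coef F w)
           (fun F H => ind_coefD F H w) (_ : _ = 0)).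
  rewrite (bigD1 w) //= big1 => [|u wu].
    by rewrite /ind_coef ffunE eqxx addr0.
  rewrite /ind_coef ffunE.
  by rewrite eq_sym (negPf wu).
by rewrite /ind_coef ffunE.
Qed.

(** Over L, the component u (x) M is M twisted by u. *)
Fact ind_eval_is_linear u :
  linear ((fun F => ind_coef (F : induced a M) u) :
            res (induced a M) -> restrict (a u^-1%g) M).
Proof.
move=> l F H; rewrite ind_coefD; congr (_ + _).
by rewrite [LHS]induced_scale_basis invg1 mul1g.
Qed.

Definition ind_eval u := Linear (ind_eval_is_linear u).

Fact ind_basis_is_linear u :
  linear (ind_basis u : restrict (a u^-1%g) M -> res (induced a M)).
Proof.
move=> l x y; apply: ind_coefP => w; rewrite ind_coefD.
rewrite [X in _ = X + _]induced_scale_basis invg1 mul1g /ind_coef !ffunE.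
by case: eqP => [->|_]; rewrite ?scaler0 ?addr0.
Qed.

Definition ind_incl u := Linear (@ind_basis_is_linear u).

Lemma Ext_eq0_summand_induced (n : nat) (T : lmodType LG)
    (i : {linear res T -> res (induced a M)})
    (r : {linear res (induced a M) -> res T}) :
  cancel i r -> Ext_eq0 n M L^o -> Ext_eq0 n T LG^o.
Proof.
move=> iK Ext0; apply: Ext_eq0_skew.
apply: (Ext_eq0_retract (N := fun u => restrict (a u^-1%g) M)
  (u := fun u => linear_comp r (ind_incl u))
  (v := fun u => linear_comp (ind_eval u) i)) => [t|u].
  by rewrite -[LHS]iK [in LHS](ind_basisE (i t)) linear_sum.
by apply: (@Ext_eq0_twist L (a u^-1%g) (a u)) Ext0 => x /=;
  rewrite -Defs.actM ?mulgV ?mulVg Defs.act1.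
Qed.

End Decomposition.

Lemma SNC_skew : SNC LG -> SNC L.
Proof.
move=> sncLG M [n [v gen_v]] Ext0.
have ind0 : zero_module (induced a M).
  apply: sncLG => [|i].
    exists n, (fun i => ind_basis 1%g (v i)) => F.
    have /fin_all_exists[c cE] u := gen_v (ind_coef F u).
    (* The generators are 1 (x) v_i, since u (x) c v_i = (u c)(1 (x) v_i). *)
    exists (fun i => \sum_u skew_basis a 1 u * skew_const a (c u i)).
    apply: ind_coefP => w.
    have coef_sum I (r : seq I) (Q : pred I) (H : I -> induced a M) :
        ind_coef (\sum_(j <- r | Q j) H j) w =
        \sum_(j <- r | Q j) ind_coef (H j) w.
      apply: (big_morph _ (fun F H => ind_coefD F H w)).
      by rewrite /ind_coef ffunE.
    rewrite coef_sum cE; apply: eq_bigr => i _.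
    rewrite scaler_suml coef_sum (bigD1 w) //= big1 ?addr0 => [|u uw].
      rewrite -scalerA induced_scale_basis induced_scale_basis.
      rewrite mulVg !invg1 mulg1 Defs.act1 rmorph1 scale1r.
      by rewrite /ind_coef ffunE eqxx.
    rewrite -scalerA induced_scale_basis induced_scale_basis.
    rewrite invg1 mul1g /ind_coef ffunE -eq_mulVg1 (negPf uw).
    by rewrite !scaler0.
  by apply: (Ext_eq0_summand_induced (i := idfun) (r := idfun)) (Ext0 i) => F.
move=> x; have := congr1 (fun F => ind_coef F 1%g) (ind0 (ind_basis 1%g x)).
by rewrite /ind_coef !ffunE eqxx.
Qed.

End ExtSkew.

(** * Simple modules: a simple LG-summand of the induced module; the case of GNC *)

(** The multiples of a nonzero element form a nonzero submodule, hence everything. *)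
Lemma simple_finitely_generated (A : pzRingType) (M : lmodType A) :
  simple_module M -> finitely_generated M.
Proof.
case=> M_neq0 simM.
have [x x_neq0] : exists x : M, x <> 0.
  by move/existsNP: M_neq0.
pose S : {pred M} := [pred y | `[< exists c : A, y = c *: x >]].
have clS : GRing.submod_closed S.
  split=> [|c y z]; first by apply/asboolP; exists 0; rewrite scale0r.
  move=> /asboolP[d ->] /asboolP[e ->]; apply/asboolP.
  by exists (c * d + e); rewrite scalerDl scalerA.
have [S0 | ST] := simM S clS.
  by case: x_neq0; apply: S0; apply/asboolP; exists 1; rewrite scale1r.
exists 1%N, (fun=> x) => y; have /asboolP[c ->] := ST y.
by exists (fun=> c); rewrite big_ord1.
Qed.

Section SimpleSummand.
Variables (G : finGroupType) (R : comPzRingType) (L : algType R).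
Variable a : alg_action G L.
Local Notation LG := (skew_group_algebra a).
Local Notation res := (restrict (@skew_const _ _ _ a)).

Variable M : lmodType L.
Hypothesis simM : simple_module M.
Local Notation X := (induced a M).
Implicit Types (T : {pred X}) (B C : {set G}) (F : X).

Definition supported B F := forall u, u \notin B -> ind_coef F u = 0.

Fact supportedP B (c : L) F H :
  supported B F -> supported B H -> supported B (c *: (F : res X) + H).
Proof.
move=> BF BH u uB; rewrite ind_coefD [X in X + _]induced_scale_basis.
by rewrite invg1 mul1g BF // BH // scaler0 addr0.
Qed.

Fact supported0 B : supported B 0.
Proof. by move=> u _; rewrite /ind_coef ffunE. Qed.

Fact supportedB B F H :
  supported B F -> supported B H -> supported B (F - H).
Proof.
move=> BF BH; rewrite addrC -[- H]/(- (H : res X)) -scaleN1r.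
exact: (@supportedP B (-1) H F).
Qed.

(** Over L, the induced module is the direct sum of T and the twists indexed by B. *)
Definition complementary T B :=
  (forall F, F \in T -> supported B F -> F = 0) /\
  (forall F, exists2 H, H \in T & supported B (F - H)).

Fact skew_closed_restrict T :
  GRing.submod_closed T -> GRing.submod_closed (T : {pred res X}).
Proof. by case=> T0 clT; split=> // c; apply: clT. Qed.

(** The usual semisimplicity argument: enlarge B while some u (x) M is not inside T plus the part
    supported on B; being simple, that twist meets the sum trivially. *)
Lemma extend_complement T B : GRing.submod_closed T ->
    (forall F, F \in T -> supported B F -> F = 0) ->
  exists2 C : {set G}, B \subset C & complementary T C.
Proof.
move=> /skew_closed_restrict clT; have [T0 TP] := clT.
have [n] := ubnP #|~: B|; elim: n B => // n IHn B leBn TB.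
pose good u (m : M) := exists2 H, H \in T & supported B (ind_basis a u m - H).
have [good_all | /existsNP[u /existsNP[m bad_m]]] :=
  pselect (forall u m, good u m).
  exists B => //; split=> // F.
  have /fin_all_exists2[H TH BH] u := good_all u (ind_coef F u).
  exists (\sum_u H u).
    pose clS := HB.pack_for (submodClosed (res X)) (T : {pred res X})
      (GRing.isSubmodClosed.Build L (res X) T clT).
    exact: (rpred_sum (S := clS)).
  rewrite {1}(ind_basisE F) -sumrB.
  apply: big_ind => //; first exact: supported0.
  by move=> x y Bx By; rewrite -[x]scale1r; apply: supportedP.
pose D : {pred M} := [pred x | `[< good u x >]].
have clD : GRing.submod_closed D.
  split=> [|c x y].
    apply/asboolP; exists 0 => //.
    rewrite [ind_basis _ _ _](linear0 (ind_incl a M u)) subr0.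
    exact: supported0.
  move=> /asboolP[H TH BH] /asboolP[K TK BK]; apply/asboolP.
  (* Moving [c] to the left across u (x) turns it into [a u c]. *)
  exists (a u c *: (H : res X) + K); first exact: TP.
  have -> : c *: x = a u c *: (x : restrict (a u^-1%g) M).
    by rewrite restrictZ /= -Defs.actM mulVg Defs.act1.
  rewrite [ind_basis _ _ _](linearP (ind_incl a M u)) opprD addrACA -scalerBr.
  exact: supportedP.
have [|D0 | DT] := simM.2 D; first exact: clD; last first.
  by case: bad_m; apply/asboolP/DT.
have uB : u \notin B.
  apply/negP => uB; apply: bad_m; exists 0 => //; rewrite subr0 => w wB.
  by rewrite /ind_coef ffunE; case: eqP wB => // ->; rewrite uB.
have [||C sBC cplC] := IHn (u |: B).
- rewrite -ltnS (leq_trans _ leBn) // ltnS proper_card //.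
  rewrite properEneq setCS subsetUr andbT.
  by apply/eqP => /setC_inj E; rewrite -E setU11 in uB.
- move=> F TF BF; apply: TB => // w wB.
  have [->|wu] := eqVneq w u; last by apply: BF; rewrite !inE negb_or wu.
  (* F itself shows that u (x) F(u) lies in T plus the part supported on B. *)
  apply: D0; apply/asboolP; exists F => // v vB.
  rewrite ind_coefD [X in _ + X](_ : _ = - ind_coef F v); last first.
    by rewrite /ind_coef ffunE.
  rewrite {1}/ind_coef ffunE; case: eqP => [->|/eqP vu]; first by rewrite subrr.
  by rewrite BF ?subr0 // !inE negb_or vu.
by exists C => //; apply: subset_trans sBC; apply: subsetUr.
Qed.

(** The descent ends because [#|~: B|] is the length of T over L, T being isomorphic to the sum of
    the simple twists outside B. *)
Lemma minimal_summand : exists (T : {pred X}) (B : {set G}),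
  [/\ GRing.submod_closed T, exists2 F, F \in T & F <> 0, complementary T B
    & forall S : {pred X}, GRing.submod_closed S -> {subset S <= T} ->
        (forall F, F \in S -> F = 0) \/ {subset T <= S}].
Proof.
have aux (n : nat) : forall T B, (#|~: B| < n)%N -> GRing.submod_closed T ->
    (exists2 F, F \in T & F <> 0) -> complementary T B ->
  exists (T : {pred X}) (B : {set G}),
  [/\ GRing.submod_closed T, exists2 F, F \in T & F <> 0, complementary T B
    & forall S : {pred X}, GRing.submod_closed S -> {subset S <= T} ->
        (forall F, F \in S -> F = 0) \/ {subset T <= S}].
  elim: n => // n IHn T B leBn clT T_neq0 [TB cplT].
  have [minT | ] := pselect (forall S : {pred X}, GRing.submod_closed S ->
    {subset S <= T} -> (forall F, F \in S -> F = 0) \/ {subset T <= S}).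
    by exists T, B.
  move=> /existsNP[S /not_implyP[clS /not_implyP[sST /not_orP[S_neq0 nsTS]]]].
  have [|C sBC cplS] := @extend_complement S B clS.
    by move=> F /sST; apply: TB.
  apply: (IHn S C) => //; last first.
    by move/existsNP: S_neq0 => [F /not_implyP[SF F0]]; exists F.
  rewrite -ltnS (leq_trans _ leBn) // ltnS proper_card //.
  rewrite properEneq setCS sBC andbT.
  (* If B also complemented the smaller S, the modular law would give S = T. *)
  apply/eqP => /setC_inj eCB; apply: nsTS => F TF.
  have [H SH] := cplS.2 F; rewrite eCB => BFH.
  suff /eqP : F - H = 0 by rewrite subr_eq0 => /eqP->.
  apply: TB => //; have [_ TP] := clT.
  by rewrite addrC -scaleN1r; apply: TP => //; apply: sST.
have [M_neq0 _] := simM; move/existsNP: M_neq0 => [x x0].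
apply: (aux #|~: (set0 : {set G})|.+1 predT set0) => //.
  exists (ind_basis a 1%g x) => // /(congr1 (fun F : X => ind_coef F 1%g)).
  by rewrite /ind_coef !ffunE eqxx.
split=> [F _ BF|F].
  by apply: ind_coefP => u; rewrite BF ?inE // /ind_coef ffunE.
by exists F; rewrite ?subrr //; apply: supported0.
Qed.

(** T is the minimal summand and [r] the projection along the part supported on B. That part need
    not be stable under G, so [r] is linear only over L. *)
Lemma simple_retract_induced :
  exists (T : lmodType LG) (i : {linear res T -> res X})
         (r : {linear res X -> res T}), simple_module T /\ cancel i r.
Proof.
have [P [B [clP [F PF F_neq0] [PB cplP] minP]]] := minimal_summand.
pose S := HB.pack_for (submodClosed X) P
  (GRing.isSubmodClosed.Build LG X P clP).
pose T : lmodType LG := submod S.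
pose val_lin : {linear T -> X} := submod_incl S.
have TB (x : T) : supported B (val x) -> x = 0.
  by move=> Bx; apply: val_inj; apply: PB Bx; apply: (valP x).
have pre (H : X) : exists t : T, `[< supported B (H - val t) >].
  by have [K PK BK] := cplP H; exists (Submod (PK : K \in S)); apply/asboolP.
pose r (H : res X) : res T := xchoose (pre H).
have rP H : supported B (H - val (r H)) by apply/asboolP/(xchooseP (pre H)).
(* Uniqueness of the T-component makes the chosen [r] linear and a retraction. *)
have rE H (t : T) : supported B (H - val t) -> r H = t.
  move=> Bt; apply/eqP; rewrite -subr_eq0; apply/eqP/TB.
  rewrite -[val _]/(val_lin (r H - t)) linearB /=.
  have -> : val (r H) - val t = (H - val t) - (H - val (r H)).
    by rewrite opprB [RHS]addrC addrA subrK.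
  exact: supportedB.
have r_lin : linear r.
  move=> c H K; apply: rE.
  have -> : c *: H + K - val (c *: r H + r K) =
      c *: (H - val (r H) : res X) + (K - val (r K)).
    by rewrite (linearP (restrict_linear _ val_lin)) /= opprD addrACA scalerBr.
  exact: supportedP.
exists T, (restrict_linear _ val_lin), (Linear r_lin); split; last first.
  by move=> t; apply: rE; rewrite subrr; apply: supported0.
split=> [T0|Q clQ].
  by case: F_neq0; rewrite -[F]/(val (Submod (PF : F \in S))) [Submod _]T0.
pose Q' : {pred X} := [pred x | `[< exists2 t : T, t \in Q & val t = x >]].
have [||Q0 | sPQ] := minP Q'.
- have [Q0 QP] := clQ; split; first by apply/asboolP; exists 0.
  move=> c x y /asboolP[s Qs <-] /asboolP[t Qt <-]; apply/asboolP.
  by exists (c *: s + t); [apply: QP | rewrite (linearP val_lin)].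
- by move=> x /asboolP[t _ <-]; apply: (valP t).
- by left=> t Qt; apply: val_inj; apply: Q0; apply/asboolP; exists t.
by right=> t; have /asboolP[s Qs /val_inj <-] := sPQ _ (valP t).
Qed.

End SimpleSummand.

Lemma GNC_skew (G : finGroupType) (R : comPzRingType) (L : algType R)
    (a : alg_action G L) : GNC (skew_group_algebra a) -> GNC L.
Proof.
move=> gncLG M _ simM.
have [T [i [r [simT iK]]]] := simple_retract_induced a simM.
have [n nExt] := gncLG T (simple_finitely_generated simT) simT.
by exists n => Ext0; apply: nExt; apply: (Ext_eq0_summand_induced iK).
Qed.

Theorem theorem1p2 (R : comPzRingType) (L : algType R) (G : finGroupType)
    (a : alg_action G L)
    (artinL : artin_algebra L)
    (invG : invertible (#|G|%:R : L))
    (stableL : G_stable a L^o) :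
  (SNC (skew_group_algebra a) -> SNC L) /\
  (GNC (skew_group_algebra a) -> GNC L).
Proof. by split; [apply: SNC_skew | apply: GNC_skew]. Qed.
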